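(* Let $C\hookrightarrow\mathbb P^g$ be a smooth projective curve of genus $g\ge 2$ over an algebraically closed field $k$, embedded by the linear system $|2D|$, where $D=\sum_{i=1}^gp_i$ with $p_1,\ldots,p_g\in C$ distinct points and $h^0(D)=1$. Let $\ell\in H^0(\mathbb P^g,\mathcal O(1))\simeq H^0(C,\mathcal O(2D))$ be the section corresponding to $1\in H^0(C,\mathcal O(2D))$, and let $H=(\ell=0)$ be the corresponding hyperplane, which is tangent to $C$ at each $p_i$. Then the components of the linear map $$T_{p_i}\to T_{p_i}H\simeq\bigoplus_{j\ne i}T_{p_i}^{2}\otimes T_{p_j}^{-2},$$ given by the tangent map at $p_i$ to the embedding $C\to\mathbb P^g$, are given by tensoring with $\alpha_{ji}\in T_{p_j}^{-2}\otimes T_{p_i}$, $j\neq i$.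
   Context: $T_{p_i}$ denotes the tangent line to $C$ at $p_i$; powers are tensor powers. Here $\mathbb P^g=\mathbb P(H^0(C,\mathcal O(2D))^* )$ is the space of lines. The isomorphism $T_{p_i}H\simeq\bigoplus_{j\ne i}T_{p_i}^2\otimes T_{p_j}^{-2}$ is defined as follows. Since $\ell|_C$ vanishes exactly along the divisor $2p_1+\cdots+2p_g$, it induces an isomorphism $\mathcal O(1)|_{p_i}\simeq\mathcal O_C(2p_i)/\mathcal O_C(p_i)\simeq T_{p_i}^2$ for each $i$. The points $p_1,\ldots,p_g$ are in general linear position in $H$, so evaluation gives $H^0(H,\mathcal O(1))\simeq\bigoplus_{i=1}^g\mathcal O(1)|_{p_i}\simeq\bigoplus_{i=1}^gT_{p_i}^2$, and hence the stated decomposition of $T_{p_i}H\simeq \mathcal O(1)|_{p_i}\otimes H^0(H,\mathcal O(1))^*/\langle \mathrm{ev}_{p_i}\rangle$. Since $H$ is tangent to $C$ at $p_i$, the tangent map to $C\to\mathbb P^g$ at $p_i$ takes values in $T_{p_i}H$. For $i\neq j$ let $r_i: H^0(C,\mathcal O(D+p_i))/H^0(C,\mathcal O)\to H^0(C,\mathcal O(2p_i)/\mathcal O(p_i))\simeq T_{p_i}^{2}$ (an isomorphism) and $r_{ij}: H^0(C,\mathcal O(D+p_i))/H^0(C,\mathcal O)\to H^0(C,\mathcal O(p_j)/\mathcal O)\simeq T_{p_j}$ be the restriction (polar part) maps; $\alpha_{ij}=r_{ij}\circ r_i^{-1}\in\mathrm{Hom}_k(T_{p_i}^{2},T_{p_j})=T_{p_i}^{-2}\otimes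 T_{p_j}$. *)

(* Defs.v *)
From HB Require Import structures.
From mathcomp Require Import all_boot all_order all_algebra.
From mathcomp Require Import boolp classical_sets.
From mathcomp Require Import freeg mpoly.

Set Implicit Arguments.
Unset Strict Implicit.
Unset Printing Implicit Defensive.

Import Order.TTheory GRing.Theory Num.Theory.
Local Open Scope ring_scope.
Local Open Scope classical_set_scope.

(* A smooth projective irreducible curve C over an algebraically closed field k
   is given as the abstract nonsingular curve of its function field K
   (Hartshorne, I.6): K is a finitely generated extension of k of transcendence
   degree 1, the points of C are the discrete valuation rings of K/k, and
   O_C(U) is the intersection of the local rings of the points of U. *)

(* x is transcendental over k and K is finite over k(x). *)
HB.mixin Record isFunctionField (k : fieldType) K
    of GRing.Field K & GRing.ComUnitAlgebra k K := {
  function_field_subproof : exists x : K,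
    (forall P : {poly k}, P != 0 -> horner_alg x P != 0) /\
    exists (n : nat) (e : 'I_n -> K), forall y : K,
      exists (Q : {poly k}) (P : 'I_n -> {poly k}),
        Q != 0 /\ horner_alg x Q * y = \sum_(i < n) horner_alg x (P i) * e i
}.

#[short(type="functionFieldType")]
HB.structure Definition FunctionField (k : fieldType) :=
  { K of GRing.Field K & GRing.ComUnitAlgebra k K & isFunctionField k K }.

Section Curve.
Variables (k : closedFieldType) (K : functionFieldType k).

(* A point is a discrete valuation ring of K/k, recorded by its normalized
   valuation; ord 0 is the junk value 0, which makes the valuation unique.
   The last clause says that the residue field is k, as it is for every closed
   point of a curve over an algebraically closed field. *)
Record curve_point := CurvePoint {
  ord : K -> int;
  ord0 : ord 0 = 0;
  ordM : forall x y, x != 0 -> y != 0 -> ord (x * y) = ord x + ord y;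
  ordD : forall x y, x != 0 -> y != 0 -> x + y != 0 ->
    Order.min (ord x) (ord y) <= ord (x + y);
  ord_const : forall c : k, c != 0 -> ord c%:A = 0;
  ord_onto : exists x, x != 0 /\ ord x = 1;
  ord_residue : forall x, x != 0 -> 0 <= ord x ->
    exists c : k, x = c%:A \/ 1 <= ord (x - c%:A)
}.

HB.instance Definition _ := gen_eqMixin curve_point.
HB.instance Definition _ := gen_choiceMixin curve_point.

(* The n-th power of the maximal ideal of the local ring at q (n in Z); as a
   subsheaf of K near q, it is the stalk of O(-nq). *)
Definition ord_ge (q : curve_point) (n : int) : {pred K} :=
  fun f => (f == 0) || (n <= ord q f).

Fact ord_ge_submod_closed q n : submod_closed (ord_ge q n).
Proof.
split=> [|a x y]; first by rewrite unfold_in /ord_ge eqxx.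
rewrite !unfold_in /ord_ge => xn yn.
have axn : (a *: x == 0) || (n <= ord q (a *: x)).
  have [->|a0] := eqVneq a 0; first by rewrite scale0r eqxx.
  have [->|x0] := eqVneq x 0; first by rewrite scaler0 eqxx.
  rewrite (negPf x0) /= in xn; apply/orP; right.
  rewrite -mulr_algl ordM// ?ord_const ?add0r//.
  by rewrite scaler_eq0 oner_eq0 orbF.
have [->|ax0] := eqVneq (a *: x) 0; first by rewrite add0r.
have [->|y0] := eqVneq y 0; first by rewrite addr0.
have [//|axy0] := eqVneq (a *: x + y) 0.
rewrite (negPf ax0) (negPf y0) /= in axn yn *.
by apply: le_trans (ordD q ax0 y0 axy0); rewrite le_min axn.
Qed.

HB.instance Definition _ q n :=
  GRing.isSubmodClosed.Build k K (ord_ge q n) (ord_ge_submod_closed q n).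

(* f(q), for f regular at q *)
Definition value (q : curve_point) (f : K) : k :=
  xget 0 [set c | f - c%:A \in ord_ge q 1].

Definition divisor := {freeg curve_point / int}.

(* H^0(C, O(E)) *)
Definition in_H0 (E : divisor) : {pred K} :=
  fun f => `[< forall q, f \in ord_ge q (- coeff q E) >].

Fact in_H0_submod_closed E : submod_closed (in_H0 E).
Proof.
split=> [|a x y]; first by rewrite unfold_in; apply/asboolP => q; exact: rpred0.
rewrite !unfold_in => /asboolP xE /asboolP yE; apply/asboolP => q.
exact: (ord_ge_submod_closed q _).2.
Qed.

HB.instance Definition _ E :=
  GRing.isSubmodClosed.Build k K (in_H0 E) (in_H0_submod_closed E).

Record H0 (E : divisor) := MkH0 { H0val :> K; _ : H0val \in in_H0 E }.
HB.instance Definition _ E := [isSub for @H0val E].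
HB.instance Definition _ E := [Choice of H0 E by <:].
HB.instance Definition _ E := [SubChoice_isSubLmodule of H0 E by <:].

Definition is_basis (V : lmodType k) (n : nat) (b : 'I_n -> V) :=
  forall v, exists! c : 'rV[k]_n, v = \sum_(i < n) c 0 i *: b i.

(* H^1(C, O) is the cokernel of K -> (+)_q K / O_q, coming from the flasque
   resolution of O by the constant sheaf K: a class is represented by a family
   of elements of K, regular at q for almost all q. *)
Definition repartition (r : curve_point -> K) :=
  exists s : seq curve_point, forall q, q \notin s -> r q \in ord_ge q 0.

Definition H1_trivial (r : curve_point -> K) :=
  exists f : K, forall q, r q - f \in ord_ge q 0.

(* g = dim H^1(C, O) *)
Definition has_genus (g : nat) :=
  exists b : 'I_g -> curve_point -> K, (forall i, repartition (b i)) /\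
    forall r, repartition r ->
      exists! c : 'rV[k]_g,
        H1_trivial (fun q => r q - \sum_(i < g) c 0 i *: b i q).

(* e generates the stalk of O(E) at q. *)
Definition frame (E : divisor) (q : curve_point) (e : K) :=
  e != 0 /\ ord q e = - coeff q E.

(* The evaluation of sections of O(E) at q, read in the frame e. As a vector of
   the dual of H^0(C, O(E)) it spans the line which is the image of q under the
   map given by |E|. *)
Definition ev (E : divisor) (q : curve_point) (e : K) (s : H0 E) : k :=
  value q (val s / e).

(* |E| embeds C in P^n: E has n + 1 independent sections b, and the map
   [b_0 : ... : b_n] is defined everywhere and is a closed immersion, i.e. it is
   injective, has closed image, and is surjective on local rings. (It is then
   a homeomorphism onto its image, both having the cofinite topology.) *)
Definition embeds (E : divisor) (n : nat) :=
  exists b : 'I_n.+1 -> H0 E,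
  [/\ is_basis b,
      forall q e, frame E q e -> exists i, ev q e (b i) != 0,
      forall q q' e e', frame E q e -> frame E q' e' ->
        (exists a : k, forall i, ev q' e' (b i) = a * ev q e (b i)) -> q = q',
      forall x : 'I_n.+1 -> k, (exists i, x i != 0) ->
        (forall (d : nat) (F : {mpoly k[n.+1]}), F \is d.-homog ->
          mmap (in_alg K) (fun i => val (b i)) F = 0 -> F.@[x] = 0) ->
        exists q e, frame E q e /\ forall i, x i = ev q e (b i) &
      forall q e f, frame E q e -> f \in ord_ge q 0 ->
        exists (d : nat) (F G : {mpoly k[n.+1]}),
          [/\ F \is d.-homog, G \is d.-homog,
              G.@[fun i => ev q e (b i)] != 0 &
              f * mmap (in_alg K) (fun i => val (b i)) G
                = mmap (in_alg K) (fun i => val (b i)) F]].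

Record maxideal (q : curve_point) :=
  MkMaxideal { maxideal_val :> K; _ : maxideal_val \in ord_ge q 1 }.
HB.instance Definition _ q := [isSub for @maxideal_val q].
HB.instance Definition _ q := [Choice of maxideal q by <:].
HB.instance Definition _ q := [SubChoice_isSubLmodule of maxideal q by <:].

(* The tangent line T_q, dual of m_q / m_q^2 *)
Definition tangent (q : curve_point) : set (maxideal q -> k) :=
  [set t | (forall a x y, t (a *: x + y) = a * t x + t y) /\
           (forall x y z : maxideal q, val z = val x * val y -> t z = 0)].

(* T_q (x) T_q, as the space of bilinear forms on m_q / m_q^2 *)
Definition tangent2 (q : curve_point) : set (maxideal q -> maxideal q -> k) :=
  [set w | (forall x, tangent (w x)) /\ (forall y, tangent (w^~ y))].

Definition tensor (q : curve_point) (t t' : maxideal q -> k) :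
    maxideal q -> maxideal q -> k :=
  fun x y => t x * t' y.

(* The derivative along t of a function f regular at q *)
Definition deriv_along (q : curve_point) (t : maxideal q -> k) (f : K) : k :=
  t (insubd 0 (f - (value q f)%:A)).

(* The polar part of f, for f in O(q): induces O(q) / O = T_q. *)
Definition polar1 (q : curve_point) (f : K) : maxideal q -> k :=
  fun x => value q (f * val x).

(* The leading polar part of f, for f in O(2q): induces
   O(2q) / O(q) = T_q (x) T_q. *)
Definition polar2 (q : curve_point) (f : K) : maxideal q -> maxideal q -> k :=
  fun x y => value q (f * val x * val y).

Section Tangency.
Variables (g : nat) (p : 'I_g -> curve_point).

Definition divD : divisor := \sum_(i < g) << p i >>.

(* alpha i j = r_ij o r_i^-1 : T_{p_i}^2 -> T_{p_j}. The choice of f in the fibre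
   of r_i is immaterial, since r_i is bijective modulo H^0(C, O). *)
Definition alpha (i j : 'I_g) (w : maxideal (p i) -> maxideal (p i) -> k) :
    maxideal (p j) -> k :=
  polar1 (val (xget (0 : H0 (divD + << p i >>)) [set f | polar2 (val f) = w])).

(* Let V = H^0(C, O(2D)) = H^0(P^g, O(1)), where P^g is the space of lines of
   the dual of V. The fibre O(1)|_{p_i} = O(2p_i) / O(p_i) is identified with
   T_{p_i}^2 by polar2, and the tangent space of P^g at p_i is
     O(1)|_{p_i} (x) V^* / <ev_{p_i}>  =  Hom(V, T_{p_i}^2) / <polar2>,
   whose elements are represented below as cosets. *)
Local Notation V := (H0 (divD *+ 2)).

(* The tangent map at p_i of C -> P^g. A frame e at p_i lifts the map to
   q |-> (s |-> (s / e)(q)) in V^*, with derivative s |-> t(s / e) along t; the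
   class of the latter in V^* / <ev_{p_i}> is the value of the tangent map on
   the vector ev p_i e of the line of p_i, to which e|_{p_i} is dual. *)
Definition tangent_map (i : 'I_g) (t : maxideal (p i) -> k) :
    set (V -> maxideal (p i) -> maxideal (p i) -> k) :=
  [set th | exists (e : K) (a : k), frame (divD *+ 2) (p i) e /\
    th = fun s x y => deriv_along t (val s / e) * polar2 e x y
                      + a * polar2 (val s) x y].

(* The equation of the hyperplane H *)
Definition ell : V := insubd 0 1.

(* T_{p_i} H, inside the tangent space of P^g at p_i *)
Definition hyperplane_tangent (i : 'I_g) :
    set (set (V -> maxideal (p i) -> maxideal (p i) -> k)) :=
  [set c | forall th, c th -> th ell = fun _ _ => 0].

(* Evaluation at the p_j identifies V / <ell> = H^0(H, O(1)) with the direct sum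
   of the T_{p_j}^2; this is a representative of the preimage of w in the j-th
   summand. *)
Definition ev_inv (j : 'I_g) (w : maxideal (p j) -> maxideal (p j) -> k) : V :=
  xget 0 [set s | polar2 (val s) = w /\
    forall m, m != j -> polar2 (q := p m) (val s) = fun _ _ => 0].

(* The component in Hom(T_{p_j}^2, T_{p_i}^2), for j != i, of an element of
   T_{p_i} H; the ambiguity by multiples of ev_{p_i} only affects the i-th
   component. *)
Definition component (i j : 'I_g)
    (c : set (V -> maxideal (p i) -> maxideal (p i) -> k))
    (w : maxideal (p j) -> maxideal (p j) -> k) :
    maxideal (p i) -> maxideal (p i) -> k :=
  xget (fun _ _ _ => 0) c (ev_inv w).

End Tangency.
End Curve.

Arguments divD {k K g} p.
Arguments alpha {k K g} p i j w.
Arguments tangent_map {k K g} p i t.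
Arguments ell {k K g} p.
Arguments hyperplane_tangent {k K g} p i.
Arguments ev_inv {k K g} p j w.
Arguments component {k K g} p i j c w.

(* Main.v *)
(* Reading off leading polar parts at the p_i maps V = H^0(C, O(2D)), which has
   dimension g + 1, to k^g with kernel H^0(C, O(D)) = k; hence this map is onto,
   and the preimage of w in T_{p_j}^2 is a function s in H^0(C, O(D + p_j)), so s
   also computes alpha_{ji}(w) as its polar part at p_i. In a frame e of
   O(2D) at p_i, the tangent map pairs t and s to t(s / e) (e x y)(p_i), whereas
   the claimed value is t(x) (s y)(p_i): both are t applied to the element
   (s / e) (e x y) = x (s y) of the maximal ideal. *)

Require Import Defs.
From mathcomp Require Import all_boot all_order all_algebra.
From mathcomp Require Import boolp classical_sets freeg mpoly.
From mathcomp Require Import zify ring.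

Set Implicit Arguments.
Unset Strict Implicit.
Unset Printing Implicit Defensive.

Import Order.TTheory GRing.Theory Num.Theory.
Local Open Scope ring_scope.

(** * Orders, residues and tangent vectors at a point of the curve *)

Section LocalRing.
Context {k : closedFieldType} {K : functionFieldType k}.
Implicit Types (q : curve_point K) (f h : K).

Lemma ord_one q : ord q 1 = 0.
Proof. by have := ord_const q (oner_neq0 k); rewrite scale1r. Qed.

Lemma ordV q f : f != 0 -> ord q f^-1 = - ord q f.
Proof.
move=> f0; have := @ordM _ _ q f f^-1 f0; rewrite invr_eq0 => /(_ f0).
by rewrite divff// ord_one; lia.
Qed.

Lemma ord_geM q m n f h :
  f \in ord_ge q m -> h \in ord_ge q n -> f * h \in ord_ge q (m + n).
Proof.
rewrite !unfold_in /ord_ge mulf_eq0.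
have [//|f0] := eqVneq f 0; have [//|h0] := eqVneq h 0.
by rewrite /= ordM// => fm hn; apply: lerD.
Qed.

Lemma ord_geW q m n f : m <= n -> f \in ord_ge q n -> f \in ord_ge q m.
Proof.
rewrite !unfold_in /ord_ge => mn /orP[->//|nf].
by rewrite (le_trans mn nf) orbT.
Qed.

Lemma ord_geE q n f : f != 0 -> (f \in ord_ge q n) = (n <= ord q f).
Proof. by rewrite unfold_in /ord_ge => /negPf->. Qed.

Lemma const_regular q (c : k) : c%:A \in ord_ge q 0.
Proof. by apply: rpredZ; rewrite ord_geE ?oner_eq0// ord_one. Qed.

Lemma const_maxideal q (c : k) : c%:A \in ord_ge q 1 -> c = 0.
Proof.
have [//|c0] := eqVneq c 0.
by rewrite ord_geE ?scaler_eq0 ?oner_eq0 ?orbF// ord_const.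
Qed.

(** [ord_residue] supplies the constant that [value] selects, so the default 0 of [xget] is not
    reached. The function 0 is treated apart because [ord_residue] excludes it. *)
Lemma valueP q f : f \in ord_ge q 0 -> f - (value q f)%:A \in ord_ge q 1.
Proof.
move=> fq; suff [c cP] : exists c : k, f - c%:A \in ord_ge q 1.
  exact: (xgetPex 0 (ex_intro [set c | f - c%:A \in ord_ge q 1]%classic c cP)).
have [->|f0] := eqVneq f 0; first by exists 0; rewrite scale0r subr0 rpred0.
move: fq; rewrite ord_geE// => /(ord_residue f0)[c [->|fc]]; exists c.
  by rewrite subrr rpred0.
by rewrite unfold_in /ord_ge fc orbT.
Qed.

(** Two constants congruent to f modulo m_q differ by a constant of m_q, which is 0. *)
Lemma value_unique q f c : f - c%:A \in ord_ge q 1 -> value q f = c.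
Proof.
move=> fc; apply/eqP; rewrite -subr_eq0; apply/eqP/(@const_maxideal q).
have fq : f \in ord_ge q 0.
  by rewrite -(subrK c%:A f) rpredD ?const_regular// (ord_geW _ fc).
by rewrite scalerBl -(subrKA f) -opprB rpredD ?rpredN ?valueP.
Qed.

Lemma value_maxideal q f : f \in ord_ge q 1 -> value q f = 0.
Proof. by move=> fq; apply: value_unique; rewrite scale0r subr0. Qed.

Lemma value0_maxideal q f :
  f \in ord_ge q 0 -> value q f = 0 -> f \in ord_ge q 1.
Proof. by move=> /valueP + f0; rewrite f0 scale0r subr0. Qed.

Lemma value_linear q a f h : f \in ord_ge q 0 -> h \in ord_ge q 0 ->
  value q (a *: f + h) = a * value q f + value q h.
Proof.
move=> /valueP fq /valueP hq; apply: value_unique.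
rewrite scalerDl -scalerA opprD addrACA -scalerBr.
by rewrite rpredD ?rpredZ.
Qed.

Lemma maxidealP q (x : maxideal q) : val x \in ord_ge q 1.
Proof. exact: valP. Qed.

Lemma uniformizer_exists q : exists u : maxideal q, ord q (val u) = 1.
Proof.
have [u [u0 u1]] := ord_onto q.
have uq : u \in ord_ge q 1 by rewrite ord_geE// u1.
by exists (MkMaxideal uq).
Qed.

Lemma uniformizer_neq0 q (u : maxideal q) : ord q (val u) = 1 -> val u != 0.
Proof. by apply: contra_eqN => /eqP->; rewrite Defs.ord0. Qed.

Lemma uniformizer_divr q (u : maxideal q) n f :
  ord q (val u) = 1 -> f \in ord_ge q (n + 1) -> f / val u \in ord_ge q n.
Proof.
move=> u1 fq; have u0 := uniformizer_neq0 u1.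
rewrite (_ : n = n + 1 - 1); last by lia.
by apply: ord_geM => //; rewrite ord_geE ?invr_eq0// ordV// u1.
Qed.

Lemma uniformizer_mulr q (u : maxideal q) n f :
  ord q (val u) = 1 -> f * val u \in ord_ge q (n + 1) -> f \in ord_ge q n.
Proof.
move=> u1 /(uniformizer_divr u1).
by rewrite mulfK// uniformizer_neq0.
Qed.

(** Write h = h(q) + c with c in m_q: then h x = h(q) x + c x, and t kills the product c x of two
    elements of m_q. *)
Lemma tangent_regularM q (t : maxideal q -> k) (x z : maxideal q) h :
  tangent t -> h \in ord_ge q 0 -> val z = h * val x ->
  t z = value q h * t x.
Proof.
move=> [tlin t0] hq zE.
pose c : maxideal q := MkMaxideal (valueP hq).
have yq : val c * val x \in ord_ge q 1.
  exact: ord_geW (ord_geM (maxidealP c) (maxidealP x)).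
pose y : maxideal q := MkMaxideal yq.
rewrite (_ : z = value q h *: x + y); first by rewrite tlin (t0 c x y)// addr0.
by apply: val_inj; rewrite /= zE mulrBl mulr_algl addrC subrK.
Qed.

(** The definition of [tangent] only kills single products; for a uniformizer u, z = (z / u) u is
    one. *)
Lemma tangent_order2 q (t : maxideal q -> k) (z : maxideal q) :
  tangent t -> val z \in ord_ge q 2 -> t z = 0.
Proof.
move=> tt z2; have [u u1] := uniformizer_exists q.
have zu : val z / val u \in ord_ge q 1 by apply: uniformizer_divr.
apply: (tt.2 (MkMaxideal zu) u) => /=.
by rewrite divfK// uniformizer_neq0.
Qed.

(** The class of u spans m_q / m_q^2, since x = (x / u) u with x / u regular. *)
Lemma tangent_ext q (u : maxideal q) (t t' : maxideal q -> k) :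
  ord q (val u) = 1 -> tangent t -> tangent t' -> t u = t' u -> t = t'.
Proof.
move=> u1 tt tt' tu; apply/funext => x.
have xu : val x / val u \in ord_ge q 0.
  by apply: uniformizer_divr => //; exact: maxidealP.
have xE : val x = val x / val u * val u by rewrite divfK// uniformizer_neq0.
by rewrite (tangent_regularM tt xu xE) (tangent_regularM tt' xu xE) tu.
Qed.

(** The one-variable case is applied in each argument. The value at (u, u) thus serves as a
    coordinate on T_q^2 in the rank count below. *)
Lemma tangent2_ext q (u : maxideal q) (w w' : maxideal q -> maxideal q -> k) :
  ord q (val u) = 1 -> tangent2 w -> tangent2 w' -> w u u = w' u u -> w = w'.
Proof.
move=> u1 [wl wr] [wl' wr'] wu; apply/funext => x.
apply: (tangent_ext u1) => //.
by have := tangent_ext u1 (wr u) (wr' u) wu => /(congr1 (@^~ x)).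
Qed.

(** * Polar parts and derivatives *)

Lemma polar1_linear q a f h (x : maxideal q) :
  f \in ord_ge q (- 1) -> h \in ord_ge q (- 1) ->
  polar1 (a *: f + h) x = a * polar1 f x + polar1 h x.
Proof.
move=> fq hq; rewrite /polar1 mulrDl -scalerAl value_linear//.
  exact: ord_geM fq (maxidealP x).
exact: ord_geM hq (maxidealP x).
Qed.

Lemma polar2_linear q a f h (x y : maxideal q) :
  f \in ord_ge q (- 2) -> h \in ord_ge q (- 2) ->
  polar2 (a *: f + h) x y = a * polar2 f x y + polar2 h x y.
Proof.
move=> fq hq; rewrite /polar2 !mulrDl -!scalerAl value_linear//.
  exact: ord_geM (ord_geM fq (maxidealP x)) (maxidealP y).
exact: ord_geM (ord_geM hq (maxidealP x)) (maxidealP y).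
Qed.

Lemma polar1_tangent q f : f \in ord_ge q (- 1) -> tangent (@polar1 _ _ q f).
Proof.
move=> fq; have fr (x : maxideal q) : f * val x \in ord_ge q 0.
  exact: (ord_geM fq (maxidealP x)).
split=> [a x y|x y z zE]; rewrite /polar1.
  by rewrite -value_linear// linearP mulrDr scalerAr.
apply: value_maxideal; rewrite zE mulrA.
exact: (ord_geM (fr x) (maxidealP y)).
Qed.

Lemma polar2_tangent2 q f : f \in ord_ge q (- 2) -> tangent2 (@polar2 _ _ q f).
Proof.
move=> fq; have fx (x : maxideal q) : f * val x \in ord_ge q (- 1).
  exact: (ord_geM fq (maxidealP x)).
split=> x; first exact: (polar1_tangent (fx x)).
rewrite (_ : _^~ x = @polar1 _ _ q (f * val x)); first exact: polar1_tangent.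
by apply/funext => y; rewrite /polar2 /polar1 mulrAC.
Qed.

(** For a uniformizer u, vanishing at (u, u) puts f u^2 in m_q, and dividing by u twice leaves at
    most a simple pole. *)
Lemma polar2_eq0 q f : f \in ord_ge q (- 2) ->
  (@polar2 _ _ q f = fun _ _ => 0) <-> f \in ord_ge q (- 1).
Proof.
move=> fq; split=> [f0|f1]; last first.
  apply/funext => x; apply/funext => y; apply: value_maxideal.
  exact: ord_geM (ord_geM f1 (maxidealP x)) (maxidealP y).
have [u u1] := uniformizer_exists q.
do 2 apply: (uniformizer_mulr u1); apply: value0_maxideal.
  exact: ord_geM (ord_geM fq (maxidealP u)) (maxidealP u).
by have := congr1 (fun w => w u u) f0.
Qed.

Lemma deriv_along_maxideal q (t : maxideal q -> k) (z : maxideal q) :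
  deriv_along t (val z) = t z.
Proof.
rewrite /deriv_along value_maxideal ?maxidealP// scale0r subr0.
by rewrite valKd.
Qed.

(** A simple pole of s against the double pole of e puts s / e in m_q, so no constant is subtracted
    in the derivative. The regular factors e x y and s y are then moved inside t. *)
Lemma deriv_along_polar2 q (t : maxideal q -> k) e s (x y : maxideal q) :
  tangent t -> e != 0 -> ord q e = - 2 -> s \in ord_ge q (- 1) ->
  deriv_along t (s / e) * polar2 e x y = t x * polar1 s y.
Proof.
move=> tt e0 e2 sq.
have zq : s / e \in ord_ge q 1.
  apply: (ord_geM sq (_ : _ \in ord_ge q 2)).
  by rewrite ord_geE ?invr_eq0 ?ordV ?e2.
have sy : s * val y \in ord_ge q 0 by exact: (ord_geM sq (maxidealP y)).
have eq : e \in ord_ge q (- 2) by rewrite ord_geE// e2.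
have exy : e * val x * val y \in ord_ge q 0.
  exact: (ord_geM (ord_geM eq (maxidealP x)) (maxidealP y)).
have xsyq : s * val y * val x \in ord_ge q 1 by exact: ord_geM sy (maxidealP x).
pose z : maxideal q := MkMaxideal zq; pose xsy : maxideal q := MkMaxideal xsyq.
rewrite -[s / e]/(val z) deriv_along_maxideal mulrC [RHS]mulrC /polar1 /polar2.
rewrite -(@tangent_regularM _ _ z xsy) -?(@tangent_regularM _ _ x xsy)//=.
by rewrite mulrC; field.
Qed.

End LocalRing.

(** * Global sections of O(D), O(D + p_j) and O(2D) *)

Section Sections.
Context {k : closedFieldType} {K : functionFieldType k}.
Variables (g : nat) (p : 'I_g -> curve_point K).
Hypothesis p_inj : injective p.
Hypothesis h0D : exists b : 'I_1 -> H0 (divD p), is_basis b.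

Lemma coeff_divD q : coeff q (divD p) = \sum_(i < g) (p i == q)%:R.
Proof.
rewrite /divD raddf_sum; apply: eq_bigr => i _ /=.
by rewrite coeffU mul1r.
Qed.

Lemma coeff_divD_point i : coeff (p i) (divD p) = 1.
Proof.
rewrite coeff_divD (bigD1 i)//= eqxx big1 ?addr0// => j ji.
by rewrite (inj_eq p_inj) (negPf ji).
Qed.

Lemma coeff_divD_out q : (forall i, q != p i) -> coeff q (divD p) = 0.
Proof.
by move=> qp; rewrite coeff_divD big1// => i _; rewrite eq_sym (negPf (qp i)).
Qed.

Lemma coeff_divD_ge0 q : 0 <= coeff q (divD p).
Proof. by rewrite coeff_divD sumr_ge0. Qed.

Lemma in_H0P E f :
  reflect (forall q, f \in ord_ge q (- coeff q E)) (f \in @in_H0 k K E).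
Proof. exact: asboolP. Qed.

Lemma H0P E (s : @H0 k K E) q : val s \in ord_ge q (- coeff q E).
Proof. by move: q; apply/in_H0P; exact: valP. Qed.

Lemma H0_2D_point (s : H0 (divD p *+ 2)) i : val s \in ord_ge (p i) (- 2).
Proof. by have := H0P s (p i); rewrite coeffMn coeff_divD_point. Qed.

Lemma one_in_H0 E : (forall q, 0 <= coeff q E) -> 1 \in @in_H0 k K E.
Proof.
move=> E0; apply/in_H0P => q; rewrite ord_geE ?oner_eq0// ord_one.
by rewrite oppr_le0.
Qed.

Lemma val_ell : val (ell p) = 1.
Proof.
rewrite /ell insubdK// one_in_H0// => q.
by rewrite coeffMn mulrn_wge0 ?coeff_divD_ge0.
Qed.

(** The function 1 lies in this one-dimensional space and is nonzero, so it spans it. *)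
Lemma H0_divD_const f : f \in in_H0 (divD p) -> exists a : k, f = a%:A.
Proof.
have [b bP] := h0D => fD.
have [c [cE _]] := bP (MkH0 fD).
have [c1 [c1E _]] := bP (MkH0 (one_in_H0 coeff_divD_ge0)).
move/(congr1 val): cE; move/(congr1 val): c1E; rewrite !big_ord1 /= => c1E ->.
have c10 : c1 0 0 != 0.
  by apply: contra_eq_neq c1E => ->; rewrite scale0r oner_eq0.
exists (c 0 0 / c1 0 0); rewrite c1E scalerA divfK//.
Qed.

(** Without leading part at p_m, the pole there is at most simple, as D allows; the double pole at
    p_j is allowed by D + p_j. *)
Lemma H0_2D_polar (s : K) j : s \in in_H0 (divD p *+ 2) ->
  (forall m, m != j -> @polar2 _ _ (p m) s = fun _ _ => 0) ->
  s \in in_H0 (divD p + << p j >>).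
Proof.
move=> s2 s0; apply/in_H0P => q.
have sq : s \in ord_ge q (- (coeff q (divD p) *+ 2)).
  by rewrite -coeffMn; move: q; apply/in_H0P.
rewrite coeffD coeffU mul1r; have [m /eqP qm|qp] := pickP (fun m => q == p m).
  rewrite qm coeff_divD_point (inj_eq p_inj) in sq *.
  have [_|jm] := eqVneq j m; first exact: sq.
  by rewrite addr0; apply/polar2_eq0/s0; rewrite // eq_sym.
have {}qp m : q != p m by rewrite qp.
by rewrite coeff_divD_out// in sq *; rewrite eq_sym (negPf (qp j)).
Qed.

Lemma in_H0_2D j (s : K) :
  s \in in_H0 (divD p + << p j >>) -> s \in in_H0 (divD p *+ 2).
Proof.
move=> /in_H0P sj; apply/in_H0P => q; apply: ord_geW (sj q).
rewrite coeffD coeffMn coeffU mul1r lerN2 mulr2n lerD2l.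
have [<-|_] := eqVneq (p j) q; last exact: coeff_divD_ge0.
by rewrite coeff_divD_point.
Qed.

Lemma H0_2D_polar_all (s : K) : s \in in_H0 (divD p *+ 2) ->
  (forall m, @polar2 _ _ (p m) s = fun _ _ => 0) -> exists a : k, s = a%:A.
Proof.
move=> /in_H0P s2 s0; apply: H0_divD_const; apply/in_H0P => q.
have {s2} := s2 q; rewrite coeffMn.
have [m /eqP->|qp] := pickP (fun m => q == p m).
  by rewrite coeff_divD_point => sm; apply/polar2_eq0/s0.
by rewrite coeff_divD_out// => m; rewrite qp.
Qed.

(** This makes the set from which [ev_inv] chooses nonempty. *)
Lemma H0_2D_surj (b : 'I_g.+1 -> H0 (divD p *+ 2)) j
    (w : maxideal (p j) -> maxideal (p j) -> k) :
  is_basis b -> tangent2 w ->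
  exists s : H0 (divD p *+ 2), polar2 (val s) = w /\
    forall m, m != j -> polar2 (q := p m) (val s) = fun _ _ => 0.
Proof.
move=> bP w2.
pose u m := sval (cid (uniformizer_exists (p m))).
have u1 m : ord (p m) (val (u m)) = 1 by rewrite /u; case: cid.
pose M := \matrix_(l < g.+1, m < g) polar2 (val (b l)) (u m) (u m).
have polarE (c : 'rV_g.+1) m :
    polar2 (val (\sum_l c 0 l *: b l)) (u m) (u m) = (c *m M) 0 m.
  rewrite mxE; under [RHS]eq_bigr do rewrite mxE.
  elim/big_rec2: _ => [|l y s _ <-].
    by rewrite /polar2 !mul0r value_maxideal ?rpred0.
  by rewrite linearP /= polar2_linear ?H0_2D_point.
have polar_ext (s : H0 (divD p *+ 2)) m w' : tangent2 w' ->
    polar2 (val s) (u m) (u m) = w' (u m) (u m) -> polar2 (val s) = w'.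
  by move=> w'2; apply: tangent2_ext => //; exact/polar2_tangent2/H0_2D_point.
have zero2 m : tangent2 (fun _ _ : maxideal (p m) => 0 : k).
  by split=> x; split=> // *; rewrite mulr0 addr0.
have [c1 [c1E _]] := bP (ell p).
(* A row in the kernel represents a section without double poles, hence a multiple of [ell];
   uniqueness of coordinates makes the row a multiple of [c1]. *)
have kerM : (kermx M <= c1)%MS.
  apply/rV_subP => c /sub_kermxP cM.
  have [|m|a aE] := @H0_2D_polar_all (val (\sum_l c 0 l *: b l)).
  - exact: valP.
  - by apply: polar_ext; rewrite ?polarE ?cM ?mxE.
  have [c' [_ c'U]] := bP (a *: ell p).
  have c'c : c' = c.
    by apply: c'U; apply: val_inj; rewrite aE linearZ /= val_ell.
  have c'c1 : c' = a *: c1.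
    apply: c'U; rewrite c1E scaler_sumr; apply: eq_bigr => l _.
    by rewrite mxE scalerA.
  by rewrite -c'c c'c1 scalemx_sub.
(* The kernel has rank g + 1 - rank M, at most 1, while M has g columns. *)
have fullM : row_full M.
  have := leq_trans (mxrankS kerM) (rank_leq_row c1).
  by rewrite mxrank_ker /row_full; have := rank_leq_col M; lia.
pose v := \row_m (if m == j then w (u j) (u j) else 0).
have [c cE] := submxP (submx_full v fullM).
exists (\sum_l c 0 l *: b l).
have sE m : polar2 (val (\sum_l c 0 l *: b l)) (u m) (u m)
            = if m == j then w (u j) (u j) else 0.
  by rewrite polarE -cE mxE.
split=> [|m mj]; apply: polar_ext => //; rewrite sE ?eqxx//.
by rewrite (negPf mj).
Qed.

End Sections.

(** * Tangency of H and comparison of the tangent map with [alpha] *)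

Theorem proposition3p3p3 (k : closedFieldType) (K : functionFieldType k)
    (g : nat) (p : 'I_g -> curve_point K) :
  (2 <= g)%N ->
  has_genus K g ->
  injective p ->
  (exists b : 'I_1 -> H0 (divD p), is_basis b) ->
  embeds (divD p *+ 2) g ->
  forall (i : 'I_g) (t : maxideal (p i) -> k), tangent t ->
    hyperplane_tangent p i (tangent_map p i t) /\
    forall j : 'I_g, j != i ->
      forall w : maxideal (p j) -> maxideal (p j) -> k, tangent2 w ->
        component p i j (tangent_map p i t) w = tensor t (alpha p j i w).
Proof.
move=> _ _ p_inj h0D [b [b_basis _ _ _ _]] i t tt.
have coeff2D : - coeff (p i) (divD p *+ 2) = - 2.
  by rewrite coeffMn coeff_divD_point.
split=> [th [e [a [[e0 e2] ->]]]|j ji w w2].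
  rewrite coeff2D in e2.
  apply/funext => x; apply/funext => y; rewrite val_ell.
  (* The section [ell] is 1, and 1 / e vanishes to order 2, so t kills it. The term in a dies as
     well, because 1 has no pole. *)
  have eV : 1 / e \in ord_ge (p i) 2.
    by rewrite div1r ord_geE ?invr_eq0// ordV// e2.
  pose z : maxideal (p i) := MkMaxideal (ord_geW (isT : (1 <= 2 :> int)) eV).
  rewrite -[1 / e]/(val z) deriv_along_maxideal tangent_order2// mul0r add0r.
  have one_pole : 1 \in ord_ge (p i) (- 1).
    by rewrite ord_geE ?oner_eq0// ord_one.
  rewrite (polar2_eq0 _).2 ?mulr0//; exact: ord_geW one_pole.
have sP := xgetPex (0 : H0 (divD p *+ 2)) (H0_2D_surj p_inj h0D b_basis w2).
rewrite -[xget _ _]/(ev_inv p j w) in sP; move: sP => [sw s0].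
set s := ev_inv p j w in sw s0 *.
have sj := H0_2D_polar p_inj (valP s) s0.
have si : val s \in ord_ge (p i) (- 1).
  by apply/polar2_eq0; [exact: H0_2D_point | apply: s0; rewrite eq_sym].
(* The section s itself shows that the fibre used by [alpha] is nonempty. *)
have fP : polar2 (val (xget (0 : H0 (divD p + << p j >>))
                            [set f | polar2 (val f) = w]%classic)) = w.
  exact: (xgetPex 0 (ex_intro [set f : H0 (divD p + << p j >>)
                              | polar2 (val f) = w]%classic (MkH0 sj) sw)).
(* The representative f chosen by [alpha] has the same leading parts as s at every p_m, so f - s is
   a constant and has no polar part at p_i. *)
have alphaE : alpha p j i w = polar1 (val s).
  rewrite /alpha; move: fP; set f := xget _ _ => fw.
  have f2 : val f \in in_H0 (divD p *+ 2) by exact: in_H0_2D (valP f).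
  have fm m : m != j -> val f \in ord_ge (p m) (- 1).
    move=> mj; have := H0P f (p m).
    rewrite coeffD coeffU coeff_divD_point// (inj_eq p_inj).
    by rewrite eq_sym (negPf mj).
  have fs2 m : polar2 (q := p m) (val f) = polar2 (val s).
    have [->|mj] := eqVneq m j; first by rewrite fw sw.
    by rewrite (s0 m mj) (polar2_eq0 _).2 ?fm// (ord_geW _ (fm m mj)).
  have [|m|a fs] := @H0_2D_polar_all _ _ _ _ p_inj h0D (val f - val s).
  - by rewrite rpredB// (valP s).
  - apply/funext => x; apply/funext => y.
    rewrite -scaleN1r addrC polar2_linear ?H0_2D_point//; last first.
      exact: (H0_2D_point p_inj (MkH0 f2)).
    by rewrite fs2 mulN1r addNr.
  apply/funext => y; rewrite -(subrK (val s) (val f)) fs.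
  rewrite polar1_linear//; last first.
    by rewrite ord_geE ?oner_eq0// ord_one.
  by rewrite /polar1 mul1r value_maxideal ?maxidealP// mulr0 add0r.
rewrite /component -/s; set th := xget _ _.
(* The coset is nonempty: for a uniformizer u at p_i, u^-2 is a frame of O(2D), taken with a = 0. *)
have [e [a [[e0 e2] ->]]] : tangent_map p i t th.
  have [u u1] := uniformizer_exists (p i); have u0 := uniformizer_neq0 u1.
  apply: xgetPex; exists (fun s x y =>
    deriv_along t (val s / (val u * val u)^-1) * polar2 (val u * val u)^-1 x y
    + 0 * polar2 (val s) x y).
  exists (val u * val u)^-1, 0; split=> //; split.
    by rewrite invr_eq0 mulf_neq0.
  by rewrite ordV ?mulf_neq0// ordM// u1 coeff2D.
rewrite coeff2D in e2.
apply/funext => x; apply/funext => y.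
(* Since s has at most a simple pole at p_i, the term in a vanishes, so the result does not depend
   on the chosen representative. *)
rewrite (deriv_along_polar2 _ _ tt e0 e2 si) (polar2_eq0 _).2 ?H0_2D_point//.
by rewrite mulr0 addr0 /tensor alphaE.
Qed.
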